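(* Let $d\ge1$, $T>0$, let $h\in C^\infty([0,T]\times\mathbf{T}^d)$ be a smooth positive solution to $\partial_th-\operatorname{div}(h\nabla h)=0$, and let $m$ be a real number in $[0,(1+\sqrt7)/2]$. Then, for all $t\in[0,T]$, $$\frac{d}{dt}\int_{\mathbf{T}^d}h^m|\nabla h|^2\,dx+I_m\le0,$$ with $$I_m=\frac{m}{m+1}\int_{\mathbf{T}^d}h^{m+1}|\Delta h|^2\,dx+C_m\int_{\mathbf{T}^d}h^{m-1}|\nabla h|^4\,dx,$$ where $$C_m=\frac{m+2}{m+1}\cdot\frac{(m+3)^2}{36}-\frac{m^2-m+2}{4}\ge0 .$$
   Context: $\mathbf{T}^d$ is a $d$-dimensional (flat) torus; $\nabla$, $\operatorname{div}$, $\Delta$ are taken with respect to $x\in\mathbf{T}^d$. *)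

(* Defs.v *)
From mathcomp Require Import all_boot all_order all_algebra.
From mathcomp Require Import all_classical all_reals all_analysis.

Set Implicit Arguments.
Unset Strict Implicit.
Unset Printing Implicit Defensive.

Import Order.TTheory GRing.Theory Num.Theory.
Import numFieldNormedType.Exports.

Local Open Scope classical_set_scope.
Local Open Scope ring_scope.

Section DerivativeWithin.
Variable R : realType.

(* Derivative relative to a subset A of the line; for A a closed interval it is
   the one-sided derivative at an endpoint. *)
Definition derivable_within (A : set R) (f : R -> R) (t : R) : Prop :=
  cvg ((f s - f t) / (s - t) @[s --> within A t^']).

Definition derive_within (A : set R) (f : R -> R) (t : R) : R :=
  lim ((f s - f t) / (s - t) @[s --> within A t^']).

End DerivativeWithin.

Section VectorCalculus.
Variables (R : realType) (d : nat).
Implicit Types (f : 'rV[R]_d -> R) (F : 'rV[R]_d -> 'rV[R]_d).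

Definition partial (i : 'I_d) f (x : 'rV[R]_d) : R := 'D_(delta_mx 0 i) f x.

Definition grad f (x : 'rV[R]_d) : 'rV[R]_d := \row_i partial i f x.

Definition divergence F (x : 'rV[R]_d) : R :=
  \sum_(i < d) partial i (fun y => F y 0 i) x.

Definition laplacian f : 'rV[R]_d -> R := divergence (grad f).

(* Square of the Euclidean norm: the library norm `|v| on 'rV[R]_d is the
   sup norm. *)
Definition sqnorm (v : 'rV[R]_d) : R := \sum_(i < d) v 0 i ^+ 2.

End VectorCalculus.

(* A flat torus is R^d / L with L the lattice spanned by the rows of an
   invertible matrix B.  Functions on it are L-periodic functions on R^d. *)
Section FlatTorus.
Variable R : realType.

Definition lattice_periodic (d : nat) (B : 'M[R]_d) (f : 'rV[R]_d -> R) : Prop :=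
  forall (i : 'I_d) (x : 'rV[R]_d), f (x + row i B) = f x.

(* Integral over the unit cube [0,1]^n of a continuous function, as an
   iterated integral over the coordinates. *)
Fixpoint cube_integral (n : nat) : ('rV[R]_n -> R) -> R :=
  match n with
  | 0 => fun f => f 0
  | n'.+1 => fun f =>
      \int[lebesgue_measure]_(s in `[0, 1])
        cube_integral (fun y : 'rV[R]_n' => f (row_mx s%:M y))
  end.

(* Integral over the fundamental cell {s *m B | s in [0,1]^d}, parametrized
   by the unit cube; `|\det B| is the Jacobian factor. *)
Definition torus_integral (d : nat) (B : 'M[R]_d) (f : 'rV[R]_d -> R) : R :=
  `|\det B| * cube_integral (fun s => f (s *m B)).

End FlatTorus.

Section SpaceTimeSmoothness.
Variables (R : realType) (d : nat) (T : R).
Implicit Types f : R -> 'rV[R]_d -> R.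

(* Directions of space-time: None is time, Some i is the i-th coordinate. *)
Definition st_derivable (o : option 'I_d) f (t : R) (x : 'rV[R]_d) : Prop :=
  match o with
  | None => derivable_within `[0, T] (f ^~ x) t
  | Some i => derivable (f t) x (delta_mx 0 i)
  end.

Definition st_partial (o : option 'I_d) f (t : R) (x : 'rV[R]_d) : R :=
  match o with
  | None => derive_within `[0, T] (f ^~ x) t
  | Some i => partial i (f t) x
  end.

(* f is C^oo on [0,T] x R^d, up to the time boundary: all iterated partial
   derivatives, in any order, exist and are jointly continuous there.  Values
   of f at times outside [0,T] are irrelevant. *)
Definition smooth_on_strip f : Prop :=
  forall l : seq (option 'I_d),
    let g := foldr st_partial f l in
    {within [set p : R * 'rV[R]_d | p.1 \in `[0, T]],
      continuous (fun p => g p.1 p.2)} /\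
    forall (o : option 'I_d) (t : R) (x : 'rV[R]_d),
      t \in `[0, T] -> st_derivable o g t x.

End SpaceTimeSmoothness.

Section Functionals.
Variables (R : realType) (d : nat) (B : 'M[R]_d).

Definition energy (m : R) (u : 'rV[R]_d -> R) : R :=
  torus_integral B (fun x => u x `^ m * sqnorm (grad u x)).

Definition C_ (m : R) : R :=
  (m + 2) / (m + 1) * ((m + 3) ^+ 2 / 36) - (m ^+ 2 - m + 2) / 4.

Definition I_ (m : R) (u : 'rV[R]_d -> R) : R :=
  m / (m + 1) *
    torus_integral B (fun x => u x `^ (m + 1) * `|laplacian u x| ^+ 2)
  + C_ m *
    torus_integral B (fun x => u x `^ (m - 1) * sqnorm (grad u x) ^+ 2).

End Functionals.

(* Main.v *)
Require Import Defs.
From mathcomp Require Import all_boot all_order all_algebra.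
From mathcomp Require Import all_classical all_reals all_analysis.
From mathcomp Require Import ring lra.

Set Implicit Arguments.
Unset Strict Implicit.
Unset Printing Implicit Defensive.

Import Order.TTheory GRing.Theory Num.Theory.
Import numFieldNormedType.Exports.

Local Open Scope classical_set_scope.
Local Open Scope ring_scope.

(** Write g, H, L for the gradient, Hessian and Laplacian of h, and N = |g|^2.
    Differentiating under the integral sign and subtracting the divergence of the
    periodic field
      G = 2 h^m h_t g + al h^m N g + be h^(m+1) (L g - H g),
    whose integral vanishes, the equation h_t = N + h L turns the integrand of
    dE/dt + I_m into
      - (m+2)/(3(m+1)) h^(m-1) (2 |h H + (m/3) g g^T|^2 + (h L + (m/3) N)^2);
    the third derivatives of h cancel by symmetry.  As for the sign of C_m, it
    equals m (3 + 2 m - 2 m^2) / (9 (m + 1)). *)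

(** * One-sided derivatives *)

(** The field [2 h^m h_t g] absorbs the term [g . grad h_t] of dE/dt, leaving only [h_t] itself,
    which the equation eliminates. The field [L g - H g] has divergence [L^2 - |H|^2], which brings
    in the full Hessian. Put lam = (m+2)/(3(m+1)). Then [be = -2 lam] is the choice that gives |H|^2
    and L^2 the weights -2 lam and -lam. With these weights any number c may stand for m/3 in both
    squares, provided that al = -(m+2)/3 + 2 lam c; the constant allowed in front of [h^(m-1) N^2]
    is then m - m(m+2)/3 + 2 m lam c - 3 lam c^2. The value c = m/3 maximizes it, and the maximum is
    C_m. The analytic obstacle lies at the ends of [[0, T]]: time derivatives are one-sided there
    and [h] is arbitrary outside. Hence a calculus relative to a set [A], with a mean value theorem
    and a symmetry of mixed derivatives that include end points. *)

Section HasDerivativeWithin.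
Variable R : realType.
Implicit Types (A : set R) (f g : R -> R) (t l : R).

(** A relation carries existence and value of the limit together, and the rules of calculus hold for
    it at every [t], even one isolated in [A]. Uniqueness of [l] enters only where the punctured
    filter is known to be proper. *)
Definition has_derivative_within A f t l : Prop :=
  (f s - f t) / (s - t) @[s --> within A t^'] --> l.

Lemma near_within_eq_cvg A t f g l :
  (forall s, A s -> s != t -> f s = g s) ->
  f s @[s --> within A t^'] --> l -> g s @[s --> within A t^'] --> l.
Proof.
move=> fg fl P /fl/=; rewrite /nbhs/= /within /dnbhs/=.
apply: filterS2 (nbhs_dnbhs_neq t) => s st Ps As; rewrite -fg //; exact: Ps.
Qed.

Let cvg_withinD A t f g l (k : R) : f s @[s --> within A t^'] --> l ->
  g s @[s --> within A t^'] --> k -> f s + g s @[s --> within A t^'] --> l + k.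
Proof. exact: cvgD. Qed.

Let cvg_withinM A t f g l (k : R) : f s @[s --> within A t^'] --> l ->
  g s @[s --> within A t^'] --> k -> f s * g s @[s --> within A t^'] --> l * k.
Proof. exact: cvgM. Qed.

Let cvg_within_cst A t (c : R) : c @[s --> within A t^'] --> c.
Proof. exact: cvg_cst. Qed.

Lemma has_derivative_withinP A f t l :
  has_derivative_within A f t l <->
  (forall e, 0 < e -> exists2 r, 0 < r & forall s, A s -> s != t ->
     `|s - t| < r -> `|(f s - f t) / (s - t) - l| < e).
Proof.
rewrite /has_derivative_within; split.
  move=> /cvgrPdist_lt H e e0; have /= := H e e0.
  rewrite near_withinE /dnbhs near_withinE => /nbhs_ballP[r r0 Hr].
  exists r => // s As st str; rewrite distrC; apply: Hr => //.
  by rewrite /ball/= distrC.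
move=> H; apply/cvgrPdist_lt => e /H[r r0 Hr].
rewrite near_withinE /dnbhs near_withinE.
apply/nbhs_ballP; exists r => // s; rewrite /ball/= => st nst As.
by rewrite distrC; apply: Hr => //; rewrite distrC.
Qed.

Lemma has_derivative_withinS A A' f t l : A' `<=` A ->
  has_derivative_within A f t l -> has_derivative_within A' f t l.
Proof.
move=> AA /has_derivative_withinP H; apply/has_derivative_withinP => e /H[r r0 Hr].
by exists r => // s /AA; exact: Hr.
Qed.

Lemma eq_has_derivative_within A f g t l : A t -> (forall s, A s -> f s = g s) ->
  has_derivative_within A f t l -> has_derivative_within A g t l.
Proof.
move=> At fg /has_derivative_withinP H.
apply/has_derivative_withinP => e /H[r r0 Hr].
by exists r => // s As; rewrite -!fg//; exact: Hr.
Qed.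

Lemma has_derivative_within_continuous A f t l :
  has_derivative_within A f t l -> f s @[s --> within A t^'] --> f t.
Proof.
move=> fl.
have s0 : s - t @[s --> within A t^'] --> t - t.
  apply: cvgB; last exact: cvg_cst.
  by move=> P tP; apply: filterS tP.
have := cvg_withinD (cvg_withinM fl s0) (@cvg_within_cst A t (f t)).
rewrite subrr mulr0 add0r; apply: near_within_eq_cvg => s _ st.
by rewrite /= divfK ?subrK// subr_eq0.
Qed.

Lemma has_derivative_within_dist A f t l : has_derivative_within A f t l ->
  forall e, 0 < e -> exists2 r, 0 < r & forall s, A s -> `|s - t| < r ->
    `|f s - f t| < e.
Proof.
move=> /has_derivative_within_continuous /cvgrPdist_lt H e e0.
have /= := H e e0.
rewrite near_withinE /dnbhs near_withinE => /nbhs_ballP[r r0 Hr].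
exists r => // s As str; have [->|st] := eqVneq s t; first by rewrite subrr normr0.
by rewrite distrC; apply: Hr => //; rewrite /ball/= distrC.
Qed.

Lemma has_derivative_within_cst A t (c : R) :
  has_derivative_within A (fun=> c) t 0.
Proof.
rewrite /has_derivative_within subrr.
by under eq_fun do rewrite mul0r; exact: cvg_cst.
Qed.

Lemma has_derivative_withinD A f g t l k : has_derivative_within A f t l ->
  has_derivative_within A g t k ->
  has_derivative_within A (fun s => f s + g s) t (l + k).
Proof.
move=> fl gk; have := cvg_withinD fl gk; apply: near_within_eq_cvg => s _ _.
by rewrite /= -mulrDl; congr (_ / _); ring.
Qed.

Lemma has_derivative_withinB A f g t l k : has_derivative_within A f t l ->
  has_derivative_within A g t k ->
  has_derivative_within A (fun s => f s - g s) t (l - k).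
Proof.
move=> fl gk; have := cvgB fl gk => H.
apply: near_within_eq_cvg (H _) => s _ _.
by rewrite /= -mulrBl; congr (_ / _); ring.
Qed.

Lemma has_derivative_withinM A f g t l k : has_derivative_within A f t l ->
  has_derivative_within A g t k ->
  has_derivative_within A (fun s => f s * g s) t (l * g t + f t * k).
Proof.
move=> fl gk.
have := cvg_withinD (cvg_withinM fl (has_derivative_within_continuous gk))
  (cvg_withinM (@cvg_within_cst A t (f t)) gk).
apply: near_within_eq_cvg => s _ _.
by rewrite /=; ring.
Qed.

Lemma has_derivative_withinT f t l :
  has_derivative_within setT f t l <-> is_derive t 1 f l.
Proof.
rewrite has_derivative_withinP; split.
  move=> H.
  have fl : h^-1 *: (f (h *: 1 + t) - f t) @[h --> 0^'] --> l.
    apply/cvgrPdist_lt => e /H[r r0 Hr].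
    rewrite /dnbhs near_withinE; apply/nbhs_ballP; exists r => //= s.
    rewrite /ball/= sub0r normrN => sr s0.
    have := Hr (s + t) I; rewrite addrK -subr_eq0 addrK => /(_ s0 sr).
    by rewrite distrC /GRing.scale/= mulr1 mulrC.
  split; first by apply/cvg_ex; exists l.
  exact: cvg_lim fl.
move=> [df dfl] e e0.
have : h^-1 *: (f (h *: 1 + t) - f t) @[h --> 0^'] --> l by rewrite -dfl.
move=> /cvgrPdist_lt /(_ e e0).
rewrite /dnbhs near_withinE => /nbhs_ballP[r r0 Hr]; exists r => // s _ st sr.
have := Hr (s - t); rewrite /ball/= sub0r normrN subr_eq0 => /(_ sr st).
by rewrite /GRing.scale/= mulr1 subrK distrC mulrC.
Qed.

Lemma has_derivative_within_comp A f (phi : R -> R) t l k :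
  has_derivative_within A f t l -> is_derive (f t) 1 phi k ->
  has_derivative_within A (phi \o f) t (k * l).
Proof.
move=> fl /has_derivative_withinT phik.
(* Carathéodory's slope function: with the value [k] at [f t] it is continuous there, and the
   factorization of the difference quotient survives at points where [f s = f t]. *)
pose psi y := if y == f t then k else (phi y - phi (f t)) / (y - f t).
have psic : psi y @[y --> f t] --> psi (f t).
  have : psi y @[y --> (f t)^'] --> psi (f t).
    rewrite {2}/psi eqxx -[in X in X --> _](@withinET _ (f t)^').
    apply: near_within_eq_cvg phik => s _ sf.
    by rewrite /psi (negbTE sf).
  by move/continuous_withinNx.
have psif : psi (f s) @[s --> within A t^'] --> k.
  have -> : k = psi (f t) by rewrite /psi eqxx.
  by apply: cvg_comp psic; exact: has_derivative_within_continuous fl.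
have := cvg_withinM psif fl; apply: near_within_eq_cvg => s _ _.
rewrite /= /psi; case: eqP => [->|/eqP fs].
  by rewrite !subrr !mul0r mulr0.
by rewrite mulrA divfK// subr_eq0.
Qed.

Lemma has_derivative_within_powR A f t l (a : R) : 0 < f t ->
  has_derivative_within A f t l ->
  has_derivative_within A (fun s => f s `^ a) t (a * f t `^ (a - 1) * l).
Proof.
move=> f0 fl.
apply: (has_derivative_within_comp (phi := fun y => y `^ a) fl).
have fin : f t \in `]0, +oo[ by rewrite in_itv/= f0.
split; first exact: derivable_powR.
by rewrite -derive1E powR_derive1.
Qed.

Lemma has_derivative_within_interior A f c l (a b : R) : `[a, b] `<=` A ->
  c \in `]a, b[ -> has_derivative_within A f c l -> is_derive c 1 f l.
Proof.
move=> abA; rewrite in_itv/= => /andP[ac cb] /has_derivative_withinP H.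
apply/has_derivative_withinT/has_derivative_withinP => e /H[r r0 Hr].
exists (Num.min r (Num.min (c - a) (b - c))).
  by rewrite !lt_min r0 !subr_gt0 ac cb.
move=> s _ sc; rewrite !lt_min => /and3P[sr sa sb]; apply: Hr => //.
apply: abA; rewrite /= in_itv/=; move: sa sb; rewrite !ltr_norml.
by move=> /andP[? ?] /andP[? ?]; apply/andP; split; lra.
Qed.

(* One-sided derivatives at the end points are enough for continuity there,
   and the points need not be ordered. *)
Lemma mean_value_within A f (df : R -> R) (s t : R) : is_interval A ->
  A s -> A t -> (forall c, A c -> has_derivative_within A f c (df c)) ->
  exists2 c, A c /\ `|c - t| <= `|s - t| & f s - f t = df c * (s - t).
Proof.
move=> itvA.
have main a b : a < b -> A a -> A b ->
    (forall c, A c -> has_derivative_within A f c (df c)) ->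
    exists2 c, a < c < b & f b - f a = df c * (b - a).
  move=> ab Aa Ab fd.
  have abA : `[a, b] `<=` A by move=> c /=; rewrite in_itv/=; exact: itvA.
  have [||c cab E] := @MVT _ f df a b ab.
  - move=> x xab; apply: (has_derivative_within_interior abA xab).
    by apply: fd; apply: abA; exact: subset_itv_oo_cc xab.
  - apply/continuous_within_itvP => //; split => [x xab||].
    + have [] := has_derivative_within_interior abA xab
        (fd _ (abA _ (subset_itv_oo_cc xab))).
      by move=> /derivable1_diffP/differentiable_continuous.
    + apply/cvgrPdist_lt => e /(has_derivative_within_dist (fd _ Aa))[r r0 Hr].
      near=> x; have ax : a < x by near: x; exact: nbhs_right_gt.
      have xb : x < b by near: x; exact: nbhs_right_lt.
      have xr : x < a + r by near: x; apply: nbhs_right_lt; rewrite ltrDl.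
      rewrite distrC; apply: Hr; first by apply: abA; rewrite /= in_itv/= !ltW.
      by rewrite gtr0_norm ?subr_gt0//; lra.
    + apply/cvgrPdist_lt => e /(has_derivative_within_dist (fd _ Ab))[r r0 Hr].
      near=> x; have xb : x < b by near: x; exact: nbhs_left_lt.
      have ax : a < x by near: x; exact: nbhs_left_gt.
      have xr : b - r < x.
        by near: x; apply: nbhs_left_gt; rewrite ltrBlDr ltrDl.
      rewrite distrC; apply: Hr; first by apply: abA; rewrite /= in_itv/= !ltW.
      by rewrite ltr0_norm ?subr_lt0//; lra.
  by exists c.
move=> As At fd; case: (ltgtP s t) => [st|ts|->].
- have [c /andP[sc ct] E] := main _ _ st As At fd.
  exists c; last by rewrite -opprB E; ring.
  split; first by apply: (itvA s t) => //; rewrite !ltW.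
  by rewrite !ltr0_norm ?subr_lt0//; lra.
- have [c /andP[sc ct] E] := main _ _ ts At As fd.
  exists c => //; split; first by apply: (itvA t s) => //; rewrite !ltW.
  by rewrite !gtr0_norm ?subr_gt0//; lra.
- by exists t => //; rewrite !subrr mulr0.
Unshelve. all: by end_near. Qed.

Lemma interval_accumulation A t a : is_interval A -> A t -> A a -> a != t ->
  forall r, 0 < r -> exists s, [/\ A s, s != t & `|s - t| < r].
Proof.
move=> itvA At Aa nat r r0.
have at0 : 0 < `|a - t| by rewrite normr_gt0 subr_eq0.
(* The point sought lies on the way from [t] to [a]: [c <= 1] keeps it in the interval, and the
   factor 2 makes its distance to [t] strictly less than [r]. *)
pose c := Num.min 1 (r / (2 * `|a - t|)).
have c0 : 0 < c by rewrite lt_min ltr01/= divr_gt0// mulr_gt0.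
have c1 : c <= 1 by rewrite ge_min lexx.
have cr : c * `|a - t| < r.
  have : c <= r / (2 * `|a - t|) by rewrite /c ge_min lexx orbT.
  by rewrite ler_pdivlMr ?mulr_gt0// => ?; lra.
exists (t + c * (a - t)); split.
- case: (ltgtP a t) => [lat|lta|eat]; last by rewrite eat subrr mulr0 addr0.
  + by apply: (itvA a t) => //; apply/andP; split; nra.
  + by apply: (itvA t a) => //; apply/andP; split; nra.
- by rewrite -subr_eq0 addrC addKr mulf_neq0 ?subr_eq0// gt_eqF.
- by rewrite addrC addKr normrM gtr0_norm.
Qed.

Lemma within_dnbhs_proper A t a : is_interval A -> A t -> A a -> a != t ->
  ProperFilter (within A t^').
Proof.
move=> itvA At Aa nat; apply: Build_ProperFilter_ex => P.
rewrite /within/= /dnbhs /within/= => /nbhs_ballP[r r0 Hr].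
have [s [As st sr]] := interval_accumulation itvA At Aa nat r0.
by exists s; apply: Hr => //; rewrite /ball/= distrC.
Qed.

(** The second point [a] says that [A] is not reduced to [t]; an interval then accumulates at [t],
    so limits along the punctured filter are unique. *)
Lemma has_derivative_within_unique A f t a l : is_interval A -> A t -> A a ->
  a != t -> has_derivative_within A f t l ->
  derivable_within A f t /\ derive_within A f t = l.
Proof.
move=> itvA At Aa nat fl; have := within_dnbhs_proper itvA At Aa nat => PF.
split; first by apply/cvg_ex; exists l.
exact: cvg_lim fl.
Qed.

(** Clairaut's theorem on a product of intervals, edges and corners included. Two mean values in
    either order write the double increment [phi x y - phi x t - phi s y + phi s t] as
    [(x - s) * (y - t)] times a value of [phi12] or of [phi21], taken at points that tend to
    [(s, t)] with [(x, y)]. *)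
Lemma mixed_derivatives_eq A1 A2 (phi phi1 phi2 phi12 phi21 : R -> R -> R)
    (s t a b : R) :
  is_interval A1 -> A1 s -> A1 a -> a != s ->
  is_interval A2 -> A2 t -> A2 b -> b != t ->
  (forall x y, A1 x -> A2 y -> has_derivative_within A1 (phi ^~ y) x (phi1 x y)) ->
  (forall x y, A1 x -> A2 y -> has_derivative_within A2 (phi x) y (phi2 x y)) ->
  (forall x y, A1 x -> A2 y -> has_derivative_within A2 (phi1 x) y (phi12 x y)) ->
  (forall x y, A1 x -> A2 y ->
     has_derivative_within A1 (phi2 ^~ y) x (phi21 x y)) ->
  {for (s, t), continuous (fun p => phi12 p.1 p.2)} ->
  {for (s, t), continuous (fun p => phi21 p.1 p.2)} ->
  phi12 s t = phi21 s t.
Proof.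
move=> itv1 As Aa nas itv2 At Ab nbt d1 d2 d12 d21 c12 c21.
have cts (g : R -> R -> R) e : 0 < e ->
    {for (s, t), continuous (fun p => g p.1 p.2)} ->
    exists2 r, 0 < r & forall x y, `|x - s| < r -> `|y - t| < r ->
      `|g x y - g s t| < e.
  move=> e0 /cvgrPdist_lt /(_ e e0) /nbhs_ballP[r r0 Hr]; exists r => // x y xs yt.
  rewrite distrC; apply: (Hr (x, y)).
  by split; rewrite /ball/= distrC.
apply/eqP; rewrite -subr_eq0 -normr_le0; apply/ler_addgt0Pl => e e0; rewrite addr0.
have e2 : 0 < e / 2 by rewrite divr_gt0.
have [r r0 Hr] := cts _ _ e2 c12; have [q q0 Hq] := cts _ _ e2 c21.
have rq0 : 0 < Num.min r q by rewrite lt_min r0.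
have [x [Ax xs]] := interval_accumulation itv1 As Aa nas rq0.
rewrite lt_min => /andP[xr xq].
have [y [Ay yt]] := interval_accumulation itv2 At Ab nbt rq0.
rewrite lt_min => /andP[yr yq].
have [|c [Ac cs] E1] := @mean_value_within A1 (fun u => phi u y - phi u t)
    (fun u => phi1 u y - phi1 u t) x s itv1 Ax As.
  by move=> c Ac; apply: has_derivative_withinB; exact: d1.
have [|k [Ak kt] E2] := @mean_value_within A2 (phi1 c) (phi12 c) y t itv2 Ay At.
  by move=> *; exact: d12.
have [|k' [Ak' kt'] E1'] := @mean_value_within A2 (fun u => phi x u - phi s u)
    (fun u => phi2 x u - phi2 s u) y t itv2 Ay At.
  by move=> *; apply: has_derivative_withinB; exact: d2.
have [|c' [Ac' cs'] E2'] :=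
    @mean_value_within A1 (phi2 ^~ k') (phi21 ^~ k') x s itv1 Ax As.
  by move=> *; exact: d21.
(* Both products equal the same double increment, and [(y - t) * (x - s)] cancels. *)
have E : phi12 c k = phi21 c' k'.
  apply: (@mulIf _ ((y - t) * (x - s))); first by rewrite mulf_neq0// subr_eq0.
  rewrite mulrA -E2 -E1 [(y - t) * _]mulrC mulrA -E2' -E1'; ring.
rewrite -(subrKA (phi12 c k)) {2}E (le_trans (ler_normD _ _))//.
rewrite [leRHS](splitr e) lerD//.
  rewrite distrC ltW//; apply: Hr; [exact: le_lt_trans cs xr|].
  exact: le_lt_trans kt yr.
by rewrite ltW//; apply: Hq; [exact: le_lt_trans cs' xq|exact: le_lt_trans kt' yq].
Qed.

End HasDerivativeWithin.

(** * Directional derivatives as derivatives along lines *)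

Section DirectionalDerivative.
Variables (R : realType) (V : normedModType R).
Implicit Types (f : V -> R) (x v : V).

Lemma derivable_line f x v (s : R) : derivable f (x + s *: v) v ->
  has_derivative_within setT (fun r => f (x + r *: v)) s ('D_v f (x + s *: v)).
Proof.
move=> df; apply/has_derivative_withinP => e e0.
have /cvgrPdist_lt/(_ e e0) : h^-1 *: (f (h *: v + (x + s *: v)) - f (x + s *: v))
   @[h --> 0^'] --> 'D_v f (x + s *: v) by exact: df.
rewrite /dnbhs near_withinE => /nbhs_ballP[r r0 Hr]; exists r => // u _ us ur.
have := Hr (u - s); rewrite /ball/= sub0r normrN subr_eq0 => /(_ ur us).
rewrite addrCA -scalerDl subrK distrC.
by rewrite [_ *: (f _ - _)]mulrC.
Qed.

Lemma derive_line f x v l :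
  has_derivative_within setT (fun r => f (x + r *: v)) 0 l -> is_derive x v f l.
Proof.
move=> /has_derivative_withinP H.
have fl : h^-1 *: (f (h *: v + x) - f x) @[h --> 0^'] --> l.
  apply/cvgrPdist_lt => e /H[r r0 Hr].
  rewrite /dnbhs near_withinE; apply/nbhs_ballP; exists r => //= s.
  rewrite /ball/= sub0r normrN => sr s0.
  have := Hr s I; rewrite subr0 scale0r addr0 => /(_ s0 sr).
  by rewrite distrC [_ *: (f _ - _)]mulrC (addrC x).
split; first by apply/cvg_ex; exists l.
exact: cvg_lim fl.
Qed.

End DirectionalDerivative.

(** * Integrals over the unit cube *)

Lemma continuous_compose (U V W : topologicalType) (g : V -> W) (f : U -> V) :
  continuous g -> continuous f -> continuous (fun u => g (f u)).
Proof. by move=> cg cf u; apply: (@cvg_comp _ _ _ f g _ _ _ (cf u)); exact: cg. Qed.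

Lemma continuous_pair (U V W : topologicalType) (f : U -> V) (g : U -> W) :
  continuous f -> continuous g -> continuous (fun u => (f u, g u)).
Proof.
move=> cf cg u.
exact: (@cvg_pair _ _ _ (nbhs u) (nbhs (f u)) (nbhs (g u)) _ _ _ f g (cf u) (cg u)).
Qed.

Section MatrixContinuity.
Variables (R : realType) (U : topologicalType).

Lemma continuous_mx (m n : nat) (f : U -> 'M[R]_(m, n)) :
  (forall i j, continuous (fun u => f u i j)) -> continuous f.
Proof.
move=> cf u; apply/cvg_ballP => e e0.
suff : \forall v \near u, forall i j, ball (f u i j) e (f v i j).
  by apply: filterS => v fv; split.
apply: filter_forall => i; apply: filter_forall => j.
by have /cvg_ballP := cf i j u; exact.
Qed.

Lemma continuous_addr (f g : U -> R) : continuous f -> continuous g ->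
  continuous (fun u => f u + g u).
Proof. by move=> cf cg u; apply: cvgD; [exact: cf|exact: cg]. Qed.

Lemma continuous_mulr (f g : U -> R) : continuous f -> continuous g ->
  continuous (fun u => f u * g u).
Proof. by move=> cf cg u; apply: cvgM; [exact: cf|exact: cg]. Qed.

Lemma continuous_sumr (I : finType) (f : I -> U -> R) :
  (forall i, continuous (f i)) -> continuous (fun u => \sum_i f i u).
Proof.
move=> cf; elim: (index_enum I) => [|i s IH].
  by under eq_fun do rewrite big_nil; exact: cst_continuous.
under eq_fun do rewrite big_cons.
exact: continuous_addr.
Qed.

Lemma continuous_mulmx (n p : nat) (B : 'M[R]_(n, p)) (f : U -> 'rV[R]_n) :
  continuous f -> continuous (fun u => f u *m B).
Proof.
move=> cf; apply: continuous_mx => i j.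
under eq_fun do rewrite mxE.
apply: continuous_sumr => k u; apply: cvgMl; move: u.
by apply: (continuous_compose (g := fun w : 'rV_n => w i k)) cf; exact: coord_continuous.
Qed.

Lemma continuous_row_mx (n : nat) (f : U -> R) (g : U -> 'rV[R]_n) :
  continuous f -> continuous g ->
  continuous (fun u => row_mx (f u)%:M (g u) : 'rV[R]_n.+1).
Proof.
move=> cf cg; apply: (@continuous_mx 1 (1 + n)) => i j.
rewrite (ord1 i); case: (split_ordP j) => k ->.
  under eq_fun do rewrite row_mxEl (ord1 k) mxE eqxx mulr1n.
  exact: cf.
under eq_fun do rewrite row_mxEr.
by apply: (continuous_compose (g := fun w : 'rV_n => w 0 k)) cg; exact: coord_continuous.
Qed.

End MatrixContinuity.

Section CubeIntegral.
Variable R : realType.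

Definition unit_cube (n : nat) : set 'rV[R]_n :=
  [set v | forall i, v ord0 i \in `[0, 1]].

Lemma unit_cube_row_mx (n : nat) (s : R) (y : 'rV[R]_n) :
  s \in `[0, 1] -> unit_cube y -> unit_cube (row_mx s%:M y : 'rV[R]_n.+1).
Proof.
move=> s01 y01.
change (forall i : 'I_(1 + n), (row_mx s%:M y : 'M[R]_(1, 1 + n)) ord0 i \in `[0, 1]).
move=> i; case: (split_ordP i) => k ->.
  by rewrite row_mxEl (ord1 k) mxE eqxx mulr1n.
by rewrite row_mxEr; exact: y01.
Qed.

(** Tube lemma: each [(t, y)] has a product neighbourhood on which [F] varies little, and
    compactness of the cube gives one radius [r] for all [y]. This uniformity is what passes limits
    under the integral. *)
Lemma uniform_unit_cube (n : nat) (F : R -> 'rV[R]_n -> R) (t e : R) : 0 < e ->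
  continuous (fun p : R * 'rV[R]_n => F p.1 p.2) ->
  exists2 r : R, 0 < r & forall s, `|s - t| < r ->
    forall y, unit_cube y -> `|F s y - F t y| < e.
Proof.
move=> e0 cF.
have /compact_near_coveringP cK : compact (@unit_cube n).
  exact: (@rV_compact _ n (fun=> `[(0 : R), 1]%classic)
    (fun=> @segment_compact R 0 1)).
have e2 : 0 < e / 2 by rewrite divr_gt0.
have : \forall s \near t, @unit_cube n `<=` [set y | `|F s y - F t y| < e].
  apply: (cK _ (nbhs t) (fun s y => `|F s y - F t y| < e)) => y Ky.
  have /cvgrPdist_lt/(_ _ e2) := cF (t, y).
  move=> [[P Q] /= [tP yQ] PQ].
  exists (Q, P) => //= -[z s] /= [Qz Ps].
  have /= H1 := PQ (s, z) (conj Ps Qz).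
  have /= H2 := PQ (t, z) (conj (nbhs_singleton tP) Qz).
  rewrite -(subrKA (F t y)) (le_lt_trans (ler_normD _ _))// [ltRHS](splitr e).
  by rewrite ltrD// distrC.
move=> /nbhs_ballP[r r0 Hr]; exists r => // s st y Ky.
by apply: Hr => //; rewrite /ball/= distrC.
Qed.

Let mu := (@lebesgue_measure R).

Lemma continuous_integrable01 (f : R -> R) : continuous f ->
  mu.-integrable `[0, 1] (EFin \o f).
Proof.
move=> cf; apply: continuous_compact_integrable; first exact: segment_compact.
exact: continuous_subspaceT.
Qed.

(** The five clauses share one induction on the dimension. The rules for the outer integral need the
    inner one to be integrable in the outer variable, which comes from the last clause one dimension
    lower; that clause in turn follows from additivity, monotonicity and the value on constants. *)
Lemma cube_integral_spec (n : nat) :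
  [/\ forall f g : 'rV[R]_n -> R, continuous f -> continuous g ->
        cube_integral (fun y => f y + g y) = cube_integral f + cube_integral g,
      forall (c : R) (f : 'rV[R]_n -> R), continuous f ->
        cube_integral (fun y => c * f y) = c * cube_integral f,
      forall f g : 'rV[R]_n -> R, continuous f -> continuous g ->
        (forall y, unit_cube y -> f y <= g y) ->
        cube_integral f <= cube_integral g,
      forall c : R, cube_integral (fun _ : 'rV[R]_n => c) = c &
      forall F : R -> 'rV[R]_n -> R,
        continuous (fun p : R * 'rV[R]_n => F p.1 p.2) ->
        continuous (fun s => cube_integral (F s))].
Proof.
have slice m (f : 'rV[R]_m.+1 -> R) : continuous f ->
    continuous (fun p : R * 'rV[R]_m => f (row_mx p.1%:M p.2 : 'rV[R]_m.+1)).
  move=> cf; apply: (continuous_compose cf).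
  apply: (@continuous_row_mx _ _ _ fst snd) => q; [exact: cvg_fst|exact: cvg_snd].
have slice2 m (f : 'rV[R]_m.+1 -> R) (s : R) : continuous f ->
    continuous (fun y : 'rV[R]_m => f (row_mx s%:M y : 'rV[R]_m.+1)).
  move=> cf; apply: (continuous_compose cf).
  apply: (@continuous_row_mx _ _ _ (fun=> s) id); first exact: cst_continuous.
  by move=> q.
have section m (F : R -> 'rV[R]_m -> R) (s : R) :
    continuous (fun p : R * 'rV[R]_m => F p.1 p.2) -> continuous (F s).
  move=> cF; apply: (continuous_compose (f := fun y => (s, y)) cF).
  apply: (continuous_pair (f := fun=> s)); first exact: cst_continuous.
  by move=> y.
(* If [F s] and [F t] differ by less than [e] on the cube, each is at most the other plus the
   constant [e]; integrating these bounds gives continuity of the integral. *)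
have cont m : (forall f g : 'rV[R]_m -> R, continuous f -> continuous g ->
      cube_integral (fun y => f y + g y) = cube_integral f + cube_integral g) ->
    (forall f g : 'rV[R]_m -> R, continuous f -> continuous g ->
        (forall y, unit_cube y -> f y <= g y) ->
        cube_integral f <= cube_integral g) ->
    (forall c : R, cube_integral (fun _ : 'rV[R]_m => c) = c) ->
    forall F : R -> 'rV[R]_m -> R,
        continuous (fun p : R * 'rV[R]_m => F p.1 p.2) ->
        continuous (fun s => cube_integral (F s)).
  move=> ID IL IC F cF t; apply/cvgrPdist_le => e e0.
  have [r r0 Hr] := uniform_unit_cube t e0 cF.
  apply/nbhs_ballP; exists r => // s; rewrite /ball/= distrC => /Hr sr.
  have le1 u v : (forall y, unit_cube y -> `|F u y - F v y| < e) ->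
      cube_integral (F u) <= cube_integral (F v) + e.
    move=> uv; rewrite -[X in _ + X]IC -ID; [|exact: section|exact: cst_continuous].
    apply: IL; [exact: section| |].
      by apply: continuous_addr; [exact: section|exact: cst_continuous].
    by move=> y /uv; rewrite ltr_norml => /andP[_ ?]; lra.
  have := le1 _ _ sr.
  have := le1 t s; rewrite ler_norml => /(_ _)/wrap[].
    by move=> y /sr; rewrite distrC.
  by move=> ? ?; apply/andP; split; lra.
elim: n => [|n [ID IZ IL IC IF]].
  split => //=.
  - by move=> f g _ _; apply=> -[].
  - move=> F cF; refine (continuous_compose (f := fun s => (s, 0 : 'rV[R]_0)) cF _).
    apply: (continuous_pair (g := fun=> (0 : 'rV[R]_0))); last exact: cst_continuous.
    by move=> s.
have ID' : forall f g : 'rV[R]_n.+1 -> R, continuous f -> continuous g ->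
    cube_integral (fun y => f y + g y) = cube_integral f + cube_integral g.
  move=> f g cf cg /=; rewrite -RintegralD//; last 2 first.
  - exact/continuous_integrable01/IF/slice.
  - exact/continuous_integrable01/IF/slice.
  by apply: eq_Rintegral => s _; rewrite ID//; exact: slice2.
have IL' : forall f g : 'rV[R]_n.+1 -> R, continuous f -> continuous g ->
    (forall y, unit_cube y -> f y <= g y) -> cube_integral f <= cube_integral g.
  move=> f g cf cg fg; apply: le_Rintegral => //.
  - exact/continuous_integrable01/IF/slice.
  - exact/continuous_integrable01/IF/slice.
  move=> s s01; apply: IL; [exact: slice2|exact: slice2|move=> y y01].
  by apply: fg; exact: unit_cube_row_mx.
have IC' : forall c : R, cube_integral (fun _ : 'rV[R]_n.+1 => c) = c.
  move=> c /=; under eq_Rintegral do rewrite IC.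
  by rewrite Rintegral_cst//= lebesgue_measure_itv/= lte01 oppr0 adde0 mulr1.
split => //; last exact: cont.
move=> c f cf /=; rewrite -RintegralZl//.
- by apply: eq_Rintegral => s _; rewrite IZ//; exact: slice2.
- exact/continuous_integrable01/IF/slice.
Qed.

End CubeIntegral.

Section CubeIntegralTheory.
Variables (R : realType) (n : nat).
Implicit Types f g : 'rV[R]_n -> R.

Lemma cube_integralD f g : continuous f -> continuous g ->
  cube_integral (fun y => f y + g y) = cube_integral f + cube_integral g.
Proof. by have [+ _ _ _ _] := @cube_integral_spec R n; exact. Qed.

Lemma cube_integralZ (c : R) f : continuous f ->
  cube_integral (fun y => c * f y) = c * cube_integral f.
Proof. by have [_ + _ _ _] := @cube_integral_spec R n; exact. Qed.

Lemma le_cube_integral f g : continuous f -> continuous g ->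
  (forall y, unit_cube y -> f y <= g y) -> cube_integral f <= cube_integral g.
Proof. by have [_ _ + _ _] := @cube_integral_spec R n; exact. Qed.

Lemma cube_integral_cst (c : R) : cube_integral (fun _ : 'rV[R]_n => c) = c.
Proof. by have [_ _ _ + _] := @cube_integral_spec R n; exact. Qed.

Lemma continuous_cube_integral (F : R -> 'rV[R]_n -> R) :
  continuous (fun p : R * 'rV[R]_n => F p.1 p.2) ->
  continuous (fun s => cube_integral (F s)).
Proof. by have [_ _ _ _ +] := @cube_integral_spec R n; exact. Qed.

Lemma cube_integralB f g : continuous f -> continuous g ->
  cube_integral (fun y => f y - g y) = cube_integral f - cube_integral g.
Proof.
move=> cf cg; rewrite -[X in _ + X]mulN1r -cube_integralZ// -cube_integralD//.
- by congr cube_integral; apply/funext => y; rewrite mulN1r.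
- by apply: continuous_mulr; [exact: cst_continuous|].
Qed.

Lemma continuous_slice (F : R -> 'rV[R]_n -> R) (s : R) :
  continuous (fun p : R * 'rV[R]_n => F p.1 p.2) -> continuous (F s).
Proof.
move=> cF; apply: (continuous_compose (f := fun y => (s, y)) cF).
by apply: (continuous_pair (f := fun=> s)); [exact: cst_continuous|move=> y].
Qed.

(** By the mean value theorem the difference quotient at [y] is a value [F' c y] with [c] no farther
    from [t] than [s]. It is therefore close to [F' t y] uniformly in [y], and monotonicity of the
    integral concludes, also at an end point of [A]. *)
Lemma cube_integral_derivative (A : set R) (F F' : R -> 'rV[R]_n -> R) (t : R) :
  is_interval A -> A t ->
  continuous (fun p : R * 'rV[R]_n => F p.1 p.2) ->
  continuous (fun p : R * 'rV[R]_n => F' p.1 p.2) ->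
  (forall s y, A s -> has_derivative_within A (F ^~ y) s (F' s y)) ->
  has_derivative_within A (fun s => cube_integral (F s)) t (cube_integral (F' t)).
Proof.
move=> itvA At cF cF' dF; apply/has_derivative_withinP => e e0.
have e2 : 0 < e / 2 by rewrite divr_gt0.
have [r r0 Hr] := uniform_unit_cube t e2 cF'.
exists r => // s As st sr.
have cFs u : continuous (F u) by exact: continuous_slice.
have cF's u : continuous (F' u) by exact: continuous_slice.
have cD : continuous (fun y => F s y - F t y).
  apply: continuous_addr => //; apply: (@continuous_compose _ _ _ -%R) => //.
  exact: opp_continuous.
have cQ : continuous (fun y => (s - t)^-1 * (F s y - F t y)).
  by apply: continuous_mulr => //; exact: cst_continuous.
have QF' y : unit_cube y -> `|(s - t)^-1 * (F s y - F t y) - F' t y| <= e / 2.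
  move=> y01.
  have [c [Ac ct] ->] := mean_value_within itvA As At (dF ^~ y).
  rewrite mulrC mulfK ?subr_eq0// ltW// Hr//.
  exact: le_lt_trans ct sr.
rewrite mulrC -cube_integralB// -cube_integralZ//.
have bnd (c : R) (k : 'rV[R]_n -> R) : continuous k ->
    continuous (fun y => k y + c).
  by move=> ck; apply: continuous_addr => //; exact: cst_continuous.
have ub : cube_integral (fun y => (s - t)^-1 * (F s y - F t y)) <=
    cube_integral (F' t) + e / 2.
  rewrite -(cube_integral_cst (e / 2)) -cube_integralD//; last exact: cst_continuous.
  apply: le_cube_integral => //; first exact: bnd.
  by move=> y /QF'; rewrite ler_norml => /andP[_]; lra.
have lb : cube_integral (F' t) - e / 2 <=
    cube_integral (fun y => (s - t)^-1 * (F s y - F t y)).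
  rewrite -(cube_integral_cst (- (e / 2))) -cube_integralD//; last exact: cst_continuous.
  apply: le_cube_integral => //; first exact: bnd.
  by move=> y /QF'; rewrite ler_norml => /andP[+ _]; lra.
by rewrite ltr_norml; apply/andP; split; lra.
Qed.

End CubeIntegralTheory.

(** * Translation invariance and integrals of derivatives of periodic functions *)

Section Translation.
Variable R : realType.
Let mu := (@lebesgue_measure R).

Lemma primitive_exists (f : R -> R) (a : R) : continuous f ->
  exists F : R -> R, forall x, a < x -> is_derive x 1 F (f x).
Proof.
move=> cf; exists (fun x => \int[mu]_(t in `[a, x]) f t) => x ax.
(* The right end [x + 1] serves only to make [x] an interior point. *)
have [||||dF Fx] := @continuous_FTC1_closed R f a x (x + 1).
- by rewrite ltrDl.
- apply: continuous_compact_integrable; first exact: segment_compact.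
  exact: continuous_subspaceT.
- exact: ax.
- exact: cf.
by split => //; rewrite -derive1E.
Qed.

(** For a primitive [F] of [f] the left side is [F (1 + s) - F s]. Its derivative in [s] is
    [f (s + 1) - f s], which vanishes by periodicity, so it does not depend on [s]. *)
Lemma integral01_translate (f : R -> R) (s : R) : continuous f ->
  (forall x, f (x + 1) = f x) ->
  \int[mu]_(x in `[0, 1]) f (x + s) = \int[mu]_(x in `[0, 1]) f x.
Proof.
(* A base point strictly below both [0] and [s], so that one primitive serves the original and the
   translated interval. *)
move=> cf f1; set a := Num.min 0 s - 1.
have a0 : a < 0.
  rewrite /a; have : Num.min 0 s <= 0 by rewrite ge_min lexx.
  lra.
have as_ : a < s.
  rewrite /a; have : Num.min 0 s <= s by rewrite ge_min lexx orbT.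
  lra.
have [F dF] := primitive_exists a cf.
have dFs c t : a < t + c -> is_derive t 1 (fun x => F (x + c)) (f (t + c)).
  move=> atc; apply/has_derivative_withinT.
  have [dF1 dF2] := dF _ atc.
  have := @derivable_line R R F c 1 t; rewrite /GRing.scale/= mulr1 addrC.
  move=> /(_ dF1); rewrite dF2; apply: eq_has_derivative_within => // u _.
  by rewrite mulr1 addrC.
have E c : a < c -> \int[mu]_(x in `[0, 1]) f (x + c) = F (1 + c) - F c.
  move=> ac.
  have cFs x : 0 <= x -> {for x, continuous (fun x => F (x + c))}.
    move=> x0; have [|+ _] := dFs c x; first lra.
    by move=> /derivable1_diffP/differentiable_continuous.
  rewrite /Rintegral (@continuous_FTC2 R (fun x => f (x + c)) (fun x => F (x + c)))//=.
  - by rewrite add0r.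
  - apply: continuous_subspaceT; apply: (continuous_compose cf).
    by apply: continuous_addr; [move=> x|exact: cst_continuous].
  - split=> [x||].
    + by rewrite in_itv/= => /andP[x0 _]; have [|] := dFs c x; first lra.
    + apply: cvg_at_right_filter; exact: cFs.
    + apply: cvg_at_left_filter; apply: cFs; exact: ler01.
  - move=> x; rewrite in_itv/= => /andP[x0 _]; rewrite derive1E.
    by have [|] := dFs c x; first lra.
rewrite E//; transitivity (\int[mu]_(x in `[0, 1]) f (x + 0)); last first.
  by apply: eq_Rintegral => x _; rewrite addr0.
rewrite E//.
have itva : is_interval [set x | a < x].
  by move=> x y /= ax ay z /andP[xz _]; exact: lt_le_trans ax xz.
have [|c _] := @mean_value_within R [set x | a < x]
    (fun x => F (x + 1) - F (x + 0)) (fun x => f (x + 1) - f (x + 0)) s 0 itva as_ a0.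
  move=> c /= ac; apply: has_derivative_withinB;
    apply: (@has_derivative_withinS _ setT) => //;
    by apply/has_derivative_withinT/dFs; lra.
rewrite !addr0 f1 subrr mul0r [s + 1]addrC [0 + 1]addrC.
by move=> /eqP; rewrite subr_eq0 !addr0 => /eqP.
Qed.

Lemma delta_mx_row_mx (n : nat) (i : 'I_n) :
  delta_mx 0 (rshift 1 i) = row_mx 0%:M (delta_mx 0 i) :> 'rV[R]_(1 + n).
Proof.
apply/rowP => j; case: (split_ordP j) => k ->.
  by rewrite row_mxEl !mxE eq_lrshift (ord1 k) mul0rn.
by rewrite row_mxEr !mxE eq_rshift.
Qed.

(** Induction on the dimension: the last coordinates of [v] are removed inside the outer integral by
    the induction hypothesis, the first one by [integral01_translate]. *)
Lemma cube_integral_translate (n : nat) (f : 'rV[R]_n -> R) (v : 'rV[R]_n) :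
  continuous f -> (forall i x, f (x + delta_mx 0 i) = f x) ->
  cube_integral (fun y => f (y + v)) = cube_integral f.
Proof.
elim: n f v => [f v _ _|n IH f v cf pf].
  by congr cube_integral; apply/funext => y; congr f; apply/rowP => -[].
have cslice : continuous (fun p : R * 'rV[R]_n => f (row_mx p.1%:M p.2 : 'rV[R]_n.+1)).
  apply: (continuous_compose cf).
  apply: (@continuous_row_mx _ _ _ fst snd) => q; [exact: cvg_fst|exact: cvg_snd].
pose v1 := lsubmx (v : 'rV[R]_(1 + n)) 0 0.
pose v2 := rsubmx (v : 'rV[R]_(1 + n)).
have vE : v = row_mx v1%:M v2 :> 'rV[R]_(1 + n).
  by rewrite -[LHS](@hsubmxK _ 1 1 n) [lsubmx _]mx11_scalar.
have addE (s r : R) (y w : 'rV[R]_n) :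
    (row_mx s%:M y : 'rV[R]_(1 + n)) + row_mx r%:M w = row_mx (s + r)%:M (y + w).
  by rewrite add_row_mx raddfD.
pose phi s := cube_integral (fun y => f (row_mx s%:M y : 'rV[R]_n.+1)).
rewrite /=; transitivity (\int[mu]_(s in `[0, 1]) phi (s + v1)).
  apply: eq_Rintegral => s _; rewrite /phi.
  rewrite -[RHS](IH _ v2).
  - congr cube_integral; apply/funext => y.
    by congr f; rewrite -addE -vE.
  - exact: (continuous_slice (F := fun s y => f (row_mx s%:M y))).
  - move=> i x; rewrite -[RHS](pf (rshift 1 i)); congr f.
    by rewrite [X in _ = _ + X]delta_mx_row_mx addE addr0.
apply: integral01_translate; first exact: continuous_cube_integral.
move=> s; rewrite /phi; congr cube_integral; apply/funext => y.
rewrite -[RHS](pf (@lshift 1 n ord0)); congr f.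
have -> : delta_mx 0 (@lshift 1 n ord0) = row_mx 1%:M 0 :> 'rV[R]_(1 + n).
  apply/rowP => j; case: (split_ordP j) => k ->.
    by rewrite row_mxEl !mxE eq_lshift (ord1 k).
  by rewrite row_mxEr !mxE eq_rlshift.
by rewrite addE addr0.
Qed.

(* Integrating a periodic function over the translates of the cell gives a
   constant; differentiating in the translation parameter yields the claim, so
   no chain rule through [B] is needed. *)
Lemma torus_integral_partial (d : nat) (B : 'M[R]_d) (G : 'rV[R]_d -> R)
    (i : 'I_d) : B \in unitmx -> lattice_periodic B G -> continuous G ->
  (forall x, derivable G x (delta_mx 0 i)) -> continuous (partial i G) ->
  torus_integral B (partial i G) = 0.
Proof.
move=> uB pG cG dG cdG; rewrite /torus_integral.
suff -> : cube_integral (fun s : 'rV[R]_d => partial i G (s *m B)) = 0.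
  by rewrite mulr0.
have itv01 : is_interval (`[(0 : R), 1]%classic) by exact: interval_is_interval.
pose w (p : R * 'rV[R]_d) : 'rV[R]_d := p.2 *m B + p.1 *: delta_mx 0 i.
have cw : continuous w.
  apply: continuous_mx => j k; rewrite /w.
  under eq_fun do rewrite 3!mxE.
  apply: continuous_addr.
    apply: continuous_sumr => l; apply: continuous_mulr; last exact: cst_continuous.
    apply: (continuous_compose (g := fun z : 'rV[R]_d => z j l)).
      exact: coord_continuous.
    by move=> q; exact: cvg_snd.
  apply: continuous_mulr; last exact: cst_continuous.
  by move=> q; exact: cvg_fst.
(* The translation length [r] plays the part of time. Only the derivative at [r = 0] matters, so
   [[0, 1]] and its one-sided derivative suffice. *)
have := @cube_integral_derivative R d (`[(0 : R), 1]%classic)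
  (fun r s => G (w (r, s))) (fun r s => partial i G (w (r, s))) 0 itv01.
have A0 : `[(0 : R), 1]%classic 0 by rewrite /= in_itv/= lexx ler01.
have A1 : `[(0 : R), 1]%classic 1 by rewrite /= in_itv/= lexx ler01.
have cw' : continuous (fun p : R * 'rV[R]_d => w (p.1, p.2)).
  rewrite (_ : (fun _ => _) = w)//; apply/funext => -[]//.
move=> /(_ A0 (continuous_compose cG cw') (continuous_compose cdG cw'))/=.
have dw (s : R) (y : 'rV[R]_d) : `[(0 : R), 1]%classic s ->
   has_derivative_within `[0, 1] (fun r => G (w (r, y))) s (partial i G (w (s, y))).
  move=> _; apply: (@has_derivative_withinS _ setT) => //.
  by apply: (@derivable_line R _ G (y *m B) (delta_mx 0 i) s); exact: dG.
move=> /(_ dw) dI.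
pose g (s : 'rV[R]_d) := G (s *m B).
have cg : continuous g.
  by apply: (continuous_compose cG); apply: continuous_mulmx => y.
(* In the coordinates of the cell, moving by [r] along the [i]-th axis is the translation by
   [r *: (delta_mx 0 i *m invmx B)], and lattice periodicity of [G] becomes periodicity of [g] under
   the unit vectors. *)
have constI (r : R) : cube_integral (fun s => G (w (r, s))) = cube_integral g.
  rewrite -(@cube_integral_translate d g (r *: (delta_mx 0 i *m invmx B)))//.
    congr cube_integral; apply/funext => y; rewrite /g /w/= mulmxDl -scalemxAl.
    by rewrite mulmxKV.
  by move=> k x; rewrite /g mulmxDl -rowE pG.
have dI0 : has_derivative_within `[0, 1]
    (fun r => cube_integral (fun s => G (w (r, s)))) 0 0.
  apply: (eq_has_derivative_within A0 (f := fun=> cube_integral g)) => [r _|].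
    by rewrite constI.
  exact: has_derivative_within_cst.
have n10 : (1 : R) != 0 by exact: oner_neq0.
have [_ E0] := has_derivative_within_unique itv01 A0 A1 n10 dI0.
have [_] := has_derivative_within_unique itv01 A0 A1 n10 dI.
rewrite E0 => ->; congr cube_integral; apply/funext => y.
by rewrite /w/= scale0r addr0.
Qed.

End Translation.

(** * Derivatives on the space-time strip *)

Section SpaceTimeDerivative.
Variables (R : realType) (d : nat) (T : R).
Implicit Types (o : option 'I_d) (f g : R -> 'rV[R]_d -> R) (x : 'rV[R]_d).

(** Both directions are instances of [has_derivative_within]: time relative to [[0, T]], space along
    a whole line at parameter 0. Each rule below is thus inherited for all directions at once. *)
Definition has_st_derivative o f t x (l : R) : Prop :=
  match o with
  | None => has_derivative_within `[0, T] (f ^~ x) t l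
  | Some i =>
    has_derivative_within setT (fun r => f t (x + r *: delta_mx 0 i)) 0 l
  end.

Lemma has_st_derivative_cst o t x (c : R) :
  has_st_derivative o (fun _ _ => c) t x 0.
Proof. by case: o => [i|] /=; exact: has_derivative_within_cst. Qed.

Lemma has_st_derivativeD o f g t x l k :
  has_st_derivative o f t x l -> has_st_derivative o g t x k ->
  has_st_derivative o (fun t x => f t x + g t x) t x (l + k).
Proof. by case: o => [i|] /=; exact: has_derivative_withinD. Qed.

Lemma has_st_derivativeB o f g t x l k :
  has_st_derivative o f t x l -> has_st_derivative o g t x k ->
  has_st_derivative o (fun t x => f t x - g t x) t x (l - k).
Proof. by case: o => [i|] /=; exact: has_derivative_withinB. Qed.

Lemma has_st_derivativeM o f g t x l k :
  has_st_derivative o f t x l -> has_st_derivative o g t x k ->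
  has_st_derivative o (fun t x => f t x * g t x) t x (l * g t x + f t x * k).
Proof.
case: o => [i|] /= fl gk; last exact: has_derivative_withinM.
by have := has_derivative_withinM fl gk; rewrite scale0r addr0.
Qed.

Lemma has_st_derivativeZ o f t x l (c : R) :
  has_st_derivative o f t x l ->
  has_st_derivative o (fun t x => c * f t x) t x (c * l).
Proof.
move=> fl; have := has_st_derivativeM (has_st_derivative_cst o t x c) fl.
by rewrite mul0r add0r.
Qed.

Lemma has_st_derivative_sum o (I : finType) (F : I -> R -> 'rV[R]_d -> R) t x
    (l : I -> R) :
  (forall i, has_st_derivative o (F i) t x (l i)) ->
  has_st_derivative o (fun t x => \sum_i F i t x) t x (\sum_i l i).
Proof.
move=> Fl; elim: (index_enum I) => [|i s IH].
  rewrite big_nil (_ : (fun _ => _) = (fun _ _ => 0)); last first.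
    by apply/funext => s; apply/funext => y; rewrite big_nil.
  exact: has_st_derivative_cst.
rewrite big_cons (_ : (fun _ => _) =
    (fun t x => F i t x + \sum_(j <- s) F j t x)); last first.
  by apply/funext => r; apply/funext => y; rewrite big_cons.
exact: has_st_derivativeD.
Qed.

Lemma has_st_derivative_powR o f t x l (a : R) : 0 < f t x ->
  has_st_derivative o f t x l ->
  has_st_derivative o (fun t x => f t x `^ a) t x (a * f t x `^ (a - 1) * l).
Proof.
case: o => [i|] /= f0 fl; last exact: has_derivative_within_powR.
have := @has_derivative_within_powR _ _ _ _ _ a _ fl.
by rewrite scale0r addr0; exact.
Qed.

End SpaceTimeDerivative.

(** * Iterated derivatives of a function that is smooth up to the time boundary *)

Section Strip.
Variables (R : realType) (d : nat) (T : R).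
Hypothesis T0 : 0 < T.
Variable h : R -> 'rV[R]_d -> R.
Hypothesis h_smooth : smooth_on_strip T h.
Implicit Types (l : seq (option 'I_d)) (x : 'rV[R]_d).

Let itv := `[(0 : R), T]%classic.

Definition clamp (t : R) : R := Num.max 0 (Num.min t T).

Lemma clamp_itv t : clamp t \in `[0, T].
Proof.
by rewrite in_itv/= /clamp le_max lexx/= ge_max ltW//= ge_min lexx orbT.
Qed.

Lemma clamp_id t : t \in `[0, T] -> clamp t = t.
Proof.
by rewrite in_itv/= => /andP[t0 tT]; rewrite /clamp min_l// max_r.
Qed.

Lemma clamp_continuous : continuous clamp.
Proof.
move=> t; apply: (@continuous_max R R (fun=> 0) (fun t => Num.min t T) t).
  exact: cst_continuous.
apply: (@continuous_min R R id (fun=> T) t); last exact: cst_continuous.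
by [].
Qed.

(* Freezing the time outside [0, T] makes the iterated derivatives jointly
   continuous on the whole of R x R^d. *)
Definition jet l (t : R) x : R := foldr (@st_partial R d T) h l (clamp t) x.

Lemma jetE l t x : t \in `[0, T] ->
  jet l t x = foldr (@st_partial R d T) h l t x.
Proof. by move=> tT; rewrite /jet clamp_id. Qed.

Lemma jet_pos t x : (forall s y, s \in `[0, T] -> 0 < h s y) -> 0 < jet [::] t x.
Proof. by apply; exact: clamp_itv. Qed.

Lemma jet_continuous l : continuous (fun p : R * 'rV[R]_d => jet l p.1 p.2).
Proof.
have [/subspace_continuousP cl _] := h_smooth l.
(* The map [q] is continuous with values in the strip, so composition with it turns continuity
   relative to the strip into continuity everywhere. *)
move=> p; pose q (z : R * 'rV[R]_d) := (clamp z.1, z.2).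
have cq : continuous q.
  apply: continuous_pair; last by move=> z; exact: cvg_snd.
  by apply: (continuous_compose clamp_continuous) => z; exact: cvg_fst.
have qS z : (q z).1 \in `[0, T] by exact: clamp_itv.
have := cl (q p) (qS p); rewrite /jet => H P /H; rewrite /= /within/= => SP.
apply: (@filterS _ (nbhs p) _ _ _ _ (cq p _ SP)) => z; apply; exact: qS.
Qed.

Lemma jet_line l i t x s :
  has_derivative_within setT (fun r => jet l t (x + r *: delta_mx 0 i)) s
    (jet (Some i :: l) t (x + s *: delta_mx 0 i)).
Proof.
apply: derivable_line; have [_ /(_ (Some i) (clamp t))] := h_smooth l.
by apply; exact: clamp_itv.
Qed.

Lemma itv_interval : is_interval itv.
Proof. exact: interval_is_interval. Qed.

Lemma itv_neq t : t \in `[0, T] -> exists2 a, itv a & a != t.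
Proof.
move=> tT; have [->|t0] := eqVneq t 0.
  by exists T; rewrite /itv/= ?in_itv/= ?(ltW T0) ?lexx// gt_eqF.
by exists 0; rewrite /itv/= ?in_itv/= ?(ltW T0) ?lexx// eq_sym.
Qed.

Lemma jet_time l t x : t \in `[0, T] ->
  has_derivative_within itv (jet l ^~ x) t (jet (None :: l) t x).
Proof.
move=> tT; have [_ /(_ None t x tT) /= H] := h_smooth l.
apply: (eq_has_derivative_within (f := foldr (@st_partial R d T) h l ^~ x)) => //.
  by move=> s sT; rewrite /jet clamp_id.
by rewrite /jet /= clamp_id//.
Qed.

Lemma jet_has_st_derivative o l t x : t \in `[0, T] ->
  has_st_derivative T o (jet l) t x (jet (o :: l) t x).
Proof.
case: o => [i|] tT; last exact: jet_time.
by have := @jet_line l i t x 0; rewrite scale0r addr0.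
Qed.

Lemma jet_partial l i t x : jet (Some i :: l) t x = partial i (jet l t) x.
Proof. by []. Qed.

Lemma continuous_jet_comp (U : topologicalType) l (a : U -> R) (b : U -> 'rV[R]_d) :
  continuous a -> continuous b -> continuous (fun u => jet l (a u) (b u)).
Proof.
move=> ca cb.
exact: (continuous_compose (@jet_continuous l) (continuous_pair ca cb)).
Qed.

Lemma jet_space_space l i j t x :
  jet [:: Some i, Some j & l] t x = jet [:: Some j, Some i & l] t x.
Proof.
(* Clairaut's theorem is applied on the plane through [x] spanned by the two directions. *)
pose w (p : R * R) := x + p.1 *: delta_mx 0 i + p.2 *: delta_mx 0 j.
have cw : continuous w.
  apply: continuous_mx => k1 k2; under eq_fun do rewrite 5!mxE.
  apply: continuous_addr; first apply: continuous_addr.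
  - exact: cst_continuous.
  - by apply: continuous_mulr; [move=> q; exact: cvg_fst|exact: cst_continuous].
  - by apply: continuous_mulr; [move=> q; exact: cvg_snd|exact: cst_continuous].
have wC (r s : R) : w (r, s) = (x + s *: delta_mx 0 j) + r *: delta_mx 0 i.
  by rewrite /w/= addrAC.
have w0 : w (0, 0) = x by rewrite /w/= !scale0r !addr0.
have T1 : is_interval [set: R] by [].
have n10 : (1 : R) != 0 by exact: oner_neq0.
have ct l' : continuous (fun p : R * R => jet l' t (w (p.1, p.2))).
  apply: continuous_jet_comp; first exact: cst_continuous.
  by rewrite (_ : (fun _ => _) = w)//; apply/funext => -[].
have := @mixed_derivatives_eq R setT setT (fun r s => jet l t (w (r, s)))
  (fun r s => jet [:: Some i & l] t (w (r, s)))
  (fun r s => jet [:: Some j & l] t (w (r, s)))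
  (fun r s => jet [:: Some j, Some i & l] t (w (r, s)))
  (fun r s => jet [:: Some i, Some j & l] t (w (r, s)))
  0 0 1 1 T1 I I n10 T1 I I n10.
rewrite /= w0 => -> //.
- move=> r s _ _; rewrite wC; under eq_fun do rewrite wC.
  exact: jet_line.
- by move=> r s _ _; exact: jet_line.
- by move=> r s _ _; exact: jet_line.
- move=> r s _ _; rewrite wC; under eq_fun do rewrite wC.
  exact: jet_line.
- exact: ct.
- exact: ct.
Qed.

(** Here the product of intervals is [[0, T]] times the line; at [t = 0] and [t = T] the time
    derivative is one-sided, so the version of Clairaut's theorem with edges is essential. *)
Lemma jet_time_space l i t x : t \in `[0, T] ->
  jet [:: None, Some i & l] t x = jet [:: Some i, None & l] t x.
Proof.
move=> tT; pose w (p : R * R) := x + p.2 *: delta_mx 0 i.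
have cw : continuous w.
  apply: continuous_mx => k1 k2; under eq_fun do rewrite 3!mxE.
  apply: continuous_addr; first exact: cst_continuous.
  by apply: continuous_mulr; [move=> q; exact: cvg_snd|exact: cst_continuous].
have w0 : w (t, 0) = x by rewrite /w/= scale0r addr0.
have T1 : is_interval [set: R] by [].
have n10 : (1 : R) != 0 by exact: oner_neq0.
have [a aT at_] := itv_neq tT.
have ct l' : continuous (fun p : R * R => jet l' p.1 (w (p.1, p.2))).
  by apply: continuous_jet_comp => // q; exact: cvg_fst.
have := @mixed_derivatives_eq R itv setT (fun r s => jet l r (w (r, s)))
  (fun r s => jet [:: None & l] r (w (r, s)))
  (fun r s => jet [:: Some i & l] r (w (r, s)))
  (fun r s => jet [:: Some i, None & l] r (w (r, s)))
  (fun r s => jet [:: None, Some i & l] r (w (r, s)))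
  t 0 a 1 itv_interval tT aT at_ T1 I I n10.
rewrite /= w0 => -> //.
- by move=> r s rT _; apply: (@jet_time l r (x + s *: delta_mx 0 i)).
- by move=> r s _ _; exact: jet_line.
- by move=> r s _ _; exact: jet_line.
- by move=> r s rT _; apply: (@jet_time (Some i :: l) r (x + s *: delta_mx 0 i)).
- exact: ct.
- exact: ct.
Qed.

Lemma jet_periodic (B : 'M[R]_d) l t :
  (forall s, s \in `[0, T] -> lattice_periodic B (h s)) ->
  lattice_periodic B (jet l t).
Proof.
move=> ph; elim: l t => [t|o l IH t] i x; first by apply: ph; exact: clamp_itv.
case: o => [k|].
  rewrite !jet_partial /partial /derive.
  rewrite (_ : (fun r : R => r^-1 *: ((jet l t \o shift (x + row i B))
      (r *: delta_mx 0 k) - jet l t (x + row i B))) = (fun r : R =>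
      r^-1 *: ((jet l t \o shift x) (r *: delta_mx 0 k) - jet l t x)))//.
  by apply/funext => r /=; rewrite IH addrA IH.
(* The time derivatives at [x] and at [x + row i B] are limits of the same quotients, by the
   induction hypothesis at all times. They agree by uniqueness of the limit. *)
have [a aT at_] := itv_neq (clamp_itv t).
have H y := @jet_time l (clamp t) y (clamp_itv t).
have cc : clamp (clamp t) = clamp t by rewrite clamp_id// clamp_itv.
have [_ E1] := has_derivative_within_unique itv_interval (clamp_itv t) aT at_ (H x).
have H' : has_derivative_within itv (jet l ^~ x) (clamp t)
    (jet (None :: l) (clamp t) (x + row i B)).
  apply: eq_has_derivative_within (H (x + row i B)) => [|s _].
    exact: clamp_itv.
  by rewrite IH.
have [_] := has_derivative_within_unique itv_interval (clamp_itv t) aT at_ H'.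
by rewrite E1 /jet cc => ->.
Qed.

End Strip.

(** * Integrals over the torus *)

Section TorusIntegral.
Variables (R : realType) (d : nat) (B : 'M[R]_d).
Implicit Types f g : 'rV[R]_d -> R.

Let continuous_cell f : continuous f -> continuous (fun s : 'rV[R]_d => f (s *m B)).
Proof.
by move=> cf; apply: (continuous_compose cf); apply: continuous_mulmx => s.
Qed.

Lemma torus_integralD f g : continuous f -> continuous g ->
  torus_integral B (fun x => f x + g x) = torus_integral B f + torus_integral B g.
Proof.
by move=> /continuous_cell cf /continuous_cell cg; rewrite -mulrDr -cube_integralD.
Qed.

Lemma torus_integralZ (c : R) f : continuous f ->
  torus_integral B (fun x => c * f x) = c * torus_integral B f.
Proof. by move=> /continuous_cell cf; rewrite mulrCA -cube_integralZ. Qed.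

Lemma torus_integral_sum (I : finType) (F : I -> 'rV[R]_d -> R) :
  (forall i, continuous (F i)) ->
  torus_integral B (fun x => \sum_i F i x) = \sum_i torus_integral B (F i).
Proof.
move=> cF.
(* Continuity of the partial sums is carried along, since additivity of the integral asks for it at
   each step. *)
suff H (s : seq I) : continuous (fun x => \sum_(i <- s) F i x) /\
    torus_integral B (fun x => \sum_(i <- s) F i x) =
    \sum_(i <- s) torus_integral B (F i) by have [] := H (index_enum I).
elim: s => [|i s [cs IH]].
  rewrite big_nil; under eq_fun do rewrite big_nil; split; first exact: cst_continuous.
  by rewrite /torus_integral cube_integral_cst mulr0.
rewrite big_cons; under eq_fun do rewrite big_cons.
split; first exact: continuous_addr.
by rewrite torus_integralD// IH.
Qed.

Lemma torus_integral_le0 f : continuous f -> (forall x, f x <= 0) ->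
  torus_integral B f <= 0.
Proof.
move=> /continuous_cell cf f0; rewrite mulr_ge0_le0// -(@cube_integral_cst R d 0).
by apply: le_cube_integral => //; exact: cst_continuous.
Qed.

End TorusIntegral.

Section JointContinuity.
Variables (R : realType) (d : nat).
Implicit Types f g : R -> 'rV[R]_d -> R.

Definition jointly_continuous f : Prop :=
  continuous (fun p : R * 'rV[R]_d => f p.1 p.2).

Lemma jointly_continuous_slice f t : jointly_continuous f -> continuous (f t).
Proof. exact: continuous_slice. Qed.

Lemma jointly_continuous_cst (c : R) : jointly_continuous (fun _ _ => c).
Proof. exact: cst_continuous. Qed.

Lemma jointly_continuousD f g : jointly_continuous f -> jointly_continuous g ->
  jointly_continuous (fun t x => f t x + g t x).
Proof. exact: continuous_addr. Qed.

Lemma jointly_continuousM f g : jointly_continuous f -> jointly_continuous g ->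
  jointly_continuous (fun t x => f t x * g t x).
Proof. exact: continuous_mulr. Qed.

Lemma jointly_continuousN f : jointly_continuous f ->
  jointly_continuous (fun t x => - f t x).
Proof.
by move=> cf; apply: (@continuous_compose _ _ _ -%R) cf; exact: opp_continuous.
Qed.

Lemma jointly_continuous_sum (I : finType) (F : I -> R -> 'rV[R]_d -> R) :
  (forall i, jointly_continuous (F i)) ->
  jointly_continuous (fun t x => \sum_i F i t x).
Proof. exact: continuous_sumr. Qed.

Lemma jointly_continuous_powR f (a : R) : (forall t x, 0 < f t x) ->
  jointly_continuous f -> jointly_continuous (fun t x => f t x `^ a).
Proof.
move=> f0 cf p; apply: (@continuous_comp _ _ _ _ (fun y : R => y `^ a)).
  exact: cf.
apply/differentiable_continuous/derivable1_diffP/derivable_powR.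
by rewrite in_itv/= f0.
Qed.

End JointContinuity.

(** * The pointwise algebraic inequality *)

Section Pointwise.
Variables (R : realType) (d : nat).

(** The left side is the divergence of [G] at a point: [p] stands for [h^(m-1)], [u] for [h], [gt]
    for the gradient of [h_t], [A] for [2 h_t + al N], [D] for the gradient of [L], and [E i j] for
    the derivative of [H i j] in direction [i]. The second hypothesis says that both third-order
    terms equal [grad L . g]; this cancels [D] and [E] from the result. *)
Lemma divergence_sum (g gt D : 'I_d -> R) (H E : 'I_d -> 'I_d -> R)
    (p u A L m be al : R) :
  \sum_i H i i = L ->
  \sum_i \sum_j E i j * g j = \sum_i D i * g i ->
  \sum_i ((m * p * g i * A
           + p * u * (2 * gt i + al * \sum_j (H i j * g j + g j * H i j))) * g i
          + p * u * A * H i i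
          + (be * ((m + 1) * (p * u) * g i) * (L * g i - \sum_j H i j * g j)
             + be * (p * u * u) * (D i * g i + L * H i i
                - \sum_j (E i j * g j + H i j * H i j)))) =
  m * p * A * \sum_i g i * g i + 2 * (p * u) * \sum_i gt i * g i
  + (2 * al - be * (m + 1)) * (p * u) * \sum_i (\sum_j H i j * g j) * g i
  + p * u * A * L + be * (m + 1) * (p * u) * L * \sum_i g i * g i
  + be * (p * u * u) * (L * L - \sum_i \sum_j H i j * H i j).
Proof.
move=> HL HE.
pose w i := \sum_j H i j * g j; pose k i := \sum_j H i j * H i j.
pose e i := \sum_j E i j * g j.
transitivity (\sum_i ((m * p * A + be * (m + 1) * (p * u) * L) * (g i * g i)
  + 2 * (p * u) * (gt i * g i) + (2 * al - be * (m + 1)) * (p * u) * (w i * g i)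
  + (p * u * A + be * (p * u * u) * L) * H i i
  + be * (p * u * u) * (D i * g i) - be * (p * u * u) * e i
  - be * (p * u * u) * k i)).
  apply: eq_bigr => i _; rewrite !big_split/= -/(w i) -/(e i) -/(k i).
  have -> : \sum_j g j * H i j = w i by apply: eq_bigr => j _; rewrite mulrC.
  ring.
rewrite !big_split/= !sumrN -!mulr_sumr HE HL; ring.
Qed.

Lemma sum_square_expand (g : 'I_d -> R) (H : 'I_d -> 'I_d -> R) (u c : R) :
  \sum_i \sum_j (u * H i j + c * (g i * g j)) ^+ 2 =
  u ^+ 2 * (\sum_i \sum_j H i j * H i j)
  + 2 * u * c * (\sum_i (\sum_j H i j * g j) * g i)
  + c ^+ 2 * (\sum_i g i * g i) ^+ 2.
Proof.
have -> : (\sum_i g i * g i) ^+ 2 = \sum_i \sum_j (g i * g i) * (g j * g j).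
  by rewrite expr2 mulr_suml; apply: eq_bigr => i _; rewrite mulr_sumr.
rewrite !mulr_sumr -!big_split/=; apply: eq_bigr => i _.
rewrite mulr_suml !mulr_sumr -!big_split/=; apply: eq_bigr => j _.
ring.
Qed.

(* The coefficients [al] and [be] of the two correction fields are those for
   which the sum becomes minus a sum of squares. *)
Lemma pointwise_dissipation (g gt D : 'I_d -> R) (H E : 'I_d -> 'I_d -> R)
    (p u ut L m : R)
    (N := \sum_i g i * g i)
    (al := - (m + 2) / 3 + 2 * m * (m + 2) / (9 * (m + 1)))
    (be := - (2 * (m + 2)) / (3 * (m + 1))) :
  0 <= p -> 0 <= m ->
  \sum_i H i i = L -> ut = N + u * L ->
  \sum_i \sum_j E i j * g j = \sum_i D i * g i ->
  m * p * ut * N + p * u * (\sum_i (gt i * g i + g i * gt i))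
  + m / (m + 1) * (p * u * u * L ^+ 2) + C_ m * (p * N ^+ 2)
  - \sum_i ((m * p * g i * (2 * ut + al * N)
           + p * u * (2 * gt i + al * \sum_j (H i j * g j + g j * H i j))) * g i
          + p * u * (2 * ut + al * N) * H i i
          + (be * ((m + 1) * (p * u) * g i) * (L * g i - \sum_j H i j * g j)
             + be * (p * u * u) * (D i * g i + L * H i i
                - \sum_j (E i j * g j + H i j * H i j)))) <= 0.
Proof.
move=> p0 m0 HL ->  HE; rewrite (divergence_sum _ _ _ _ _ _ _ HL HE) -/N.
have m1 : m + 1 != 0 by rewrite gt_eqF// ltr_wpDl.
rewrite big_split/=.
have -> : \sum_i g i * gt i = \sum_i gt i * g i.
  by apply: eq_bigr => i _; rewrite mulrC.
set Q := \sum_i gt i * g i.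
have SQ := sum_square_expand g H u (m / 3); rewrite -/N in SQ.
set S := \sum_i (\sum_j _) * _ in SQ *.
set K := \sum_i \sum_j H i j * H i j in SQ *.
set W := \sum_i _ in SQ *.
have W0 : 0 <= W by apply: sumr_ge0 => i _; apply: sumr_ge0 => j _; exact: sqr_ge0.
(* After [h_t] has been replaced, all is polynomial in [p], [u], [N], [L], [Q], [S], [K] apart from
   denominators in [m]. Nonnegativity of [W] is secured first; expanding it by [SQ] then leaves an
   identity for [field]. *)
rewrite [leLHS](_ : _ = - ((m + 2) / (3 * (m + 1)) *
    (p * (2 * W + (u * L + m / 3 * N) ^+ 2)))).
  rewrite oppr_le0; apply: mulr_ge0; first by rewrite divr_ge0 ?mulr_ge0 ?addr_ge0.
  by rewrite mulr_ge0// addr_ge0 ?sqr_ge0// mulr_ge0.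
rewrite SQ /C_ /al /be; field; exact: m1.
Qed.

End Pointwise.

(** * Energy dissipation *)

Lemma C_ge0 (R : realType) (m : R) :
  0 <= m -> m <= (1 + Num.sqrt 7) / 2 -> 0 <= C_ m.
Proof.
move=> m0 mq; set q : R := Num.sqrt 7 in mq.
have q2 : q ^+ 2 = 7 by rewrite sqr_sqrtr.
have q0 : 0 <= q by exact: sqrtr_ge0.
have m1 : m + 1 != 0 by rewrite gt_eqF// ltr_wpDl.
have -> : C_ m = m * (3 + 2 * m - 2 * m ^+ 2) / (9 * (m + 1)).
  by rewrite /C_; field.
(* For [m >= 0] this makes [q + (2 * m - 1)] nonnegative. The product below is [7 - (2 m - 1)^2],
   twice the quadratic factor of [C_ m], whose larger root is the upper bound on [m]. *)
have q1 : 1 <= q by nra.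
have : 0 <= (q - (2 * m - 1)) * (q + (2 * m - 1)) by apply: mulr_ge0; lra.
rewrite -subr_sqr q2 => q3; apply: divr_ge0; last by lra.
by apply: mulr_ge0 => //; lra.
Qed.

Lemma powR_succ (R : realType) (x a : R) : 0 < x -> x `^ (a + 1) = x `^ a * x.
Proof.
by move=> x0; rewrite powRD ?powRr1 ?(ltW x0)// (gt_eqF x0) implybT.
Qed.

Section Dissipation.
Variables (R : realType) (d : nat) (B : 'M[R]_d) (T : R).
Hypotheses (uB : B \in unitmx) (T0 : 0 < T).
Variable h : R -> 'rV[R]_d -> R.
Hypotheses (h_periodic : forall t, t \in `[0, T] -> lattice_periodic B (h t))
  (h_smooth : smooth_on_strip T h)
  (h_pos : forall t x, t \in `[0, T] -> 0 < h t x).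
Variable m : R.

Local Notation J := (jet T h).
Local Notation u := (J [::]).
Local Notation ut := (J [:: None]).
Local Notation g i := (J [:: Some i]).
Local Notation H i j := (J [:: Some i; Some j]).

Let u0 t x : 0 < u t x.
Proof. exact: jet_pos. Qed.

Let cJ l : jointly_continuous (J l).
Proof. exact: jet_continuous. Qed.

Let cu a : jointly_continuous (fun t x => u t x `^ a).
Proof. exact: jointly_continuous_powR. Qed.

Ltac jcont := lazymatch goal with
  | |- jointly_continuous (fun t x => @?f t x + @?k t x) =>
    apply: (@jointly_continuousD _ _ f k); cbv beta; jcont
  | |- jointly_continuous (fun t x => @?f t x * @?k t x) =>
    apply: (@jointly_continuousM _ _ f k); cbv beta; jcont
  | |- jointly_continuous (fun t x => - @?f t x) =>
    apply: (@jointly_continuousN _ _ f); cbv beta; jcont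
  | |- jointly_continuous (fun t x => @?f t x ^+ 2) =>
    apply: (@jointly_continuousM _ _ f f); cbv beta; jcont
  | |- jointly_continuous (fun t x => _ `^ _) => exact: cu
  | |- jointly_continuous (fun t x => jet _ _ _ t x) => exact: cJ
  | |- jointly_continuous (fun t x => bigop.body _ _ _) =>
    apply: jointly_continuous_sum => ?; cbv beta; jcont
  | |- jointly_continuous (fun t x => ?c) => exact: jointly_continuous_cst
  end.

Let dJ o l t x : t \in `[0, T] -> has_st_derivative T o (J l) t x (J (o :: l) t x).
Proof. exact: jet_has_st_derivative. Qed.

Let du o a t x : t \in `[0, T] ->
  has_st_derivative T o (fun t x => u t x `^ a) t x
    (a * u t x `^ (a - 1) * J [:: o] t x).
Proof. by move=> tT; apply: has_st_derivative_powR => //; exact: dJ. Qed.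

(** Written with jets, the integrand is jointly continuous at all times; it is the integrand of
    [energy] for [t] in [[0, T]]. *)
Let density t x := u t x `^ m * \sum_i g i t x * g i t x.

Let density' t x := m * u t x `^ (m - 1) * ut t x * (\sum_i g i t x * g i t x)
  + u t x `^ m * \sum_i (J [:: None; Some i] t x * g i t x
                         + g i t x * J [:: None; Some i] t x).

Let density_derivative t x : t \in `[0, T] ->
  has_st_derivative T None density t x (density' t x).
Proof.
move=> tT; apply: has_st_derivativeM; first exact: du.
by apply: has_st_derivative_sum => i; apply: has_st_derivativeM; exact: dJ.
Qed.

Let al : R := - (m + 2) / 3 + 2 * m * (m + 2) / (9 * (m + 1)).
Let be : R := - (2 * (m + 2)) / (3 * (m + 1)).

Let A t x := 2 * ut t x + al * \sum_j g j t x * g j t x.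

(** Component [i] of [G], as a function of the derivatives [j] of [h] at one point. Its periodicity
    thus reduces to that of the jets. *)
Let field_jet i (j : seq (option 'I_d) -> R) : R :=
  j [::] `^ m * (2 * j [:: None] + al * \sum_k j [:: Some k] * j [:: Some k])
    * j [:: Some i]
  + be * j [::] `^ (m + 1) * ((\sum_k j [:: Some k; Some k]) * j [:: Some i]
                             - \sum_k j [:: Some i; Some k] * j [:: Some k]).

Let field i t x := field_jet i (fun l => J l t x).

(** One summand of the divergence of [G]. It keeps the shape that the product rules produce, down to
    the exponent [m + 1 - 1], so that [field_derivative] follows by applying them. *)
Let field' i t x :=
  (m * u t x `^ (m - 1) * g i t x * A t x
   + u t x `^ m * (2 * J [:: Some i; None] t x
       + al * \sum_j (H i j t x * g j t x + g j t x * H i j t x))) * g i t x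
  + u t x `^ m * A t x * H i i t x
  + (be * ((m + 1) * u t x `^ (m + 1 - 1) * g i t x) *
       ((\sum_j H j j t x) * g i t x - \sum_j H i j t x * g j t x)
     + be * u t x `^ (m + 1) *
       ((\sum_j J [:: Some i; Some j; Some j] t x) * g i t x
        + (\sum_j H j j t x) * H i i t x
        - \sum_j (J [:: Some i; Some i; Some j] t x * g j t x
                  + H i j t x * H i j t x))).

Let field_derivative i t x : t \in `[0, T] ->
  has_st_derivative T (Some i) (field i) t x (field' i t x).
Proof.
move=> tT; rewrite /field /field_jet; cbv beta; apply: has_st_derivativeD.
  apply: has_st_derivativeM; last exact: dJ.
  apply: has_st_derivativeM; first exact: du.
  apply: has_st_derivativeD; first by apply: has_st_derivativeZ; exact: dJ.
  apply: has_st_derivativeZ; apply: has_st_derivative_sum => j.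
  by apply: has_st_derivativeM; exact: dJ.
apply: has_st_derivativeM; first by apply: has_st_derivativeZ; exact: du.
apply: has_st_derivativeB.
  apply: has_st_derivativeM; last exact: dJ.
  by apply: has_st_derivative_sum => j; exact: dJ.
apply: has_st_derivative_sum => j.
by apply: has_st_derivativeM; exact: dJ.
Qed.

Let density_continuous : jointly_continuous density.
Proof. rewrite /density; jcont. Qed.

Let density'_continuous : jointly_continuous density'.
Proof. rewrite /density'; jcont. Qed.

Let field_continuous i : jointly_continuous (field i).
Proof. rewrite /field /field_jet; cbv beta; jcont. Qed.

Let field'_continuous i : jointly_continuous (field' i).
Proof. rewrite /field' /A; jcont. Qed.

Let field_partial i t : t \in `[0, T] -> partial i (field i t) = field' i t.
Proof.
move=> tT; apply/funext => x; rewrite /partial.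
by have /derive_line[_ ->] := @field_derivative i t x tT.
Qed.

Let field_integral i t : t \in `[0, T] -> torus_integral B (field' i t) = 0.
Proof.
move=> tT; rewrite -field_partial//; apply: torus_integral_partial => //.
- move=> k x; have pJ l : J l t (x + row k B) = J l t x by exact: jet_periodic.
  by congr field_jet; apply/funext => l.
- exact: (@jointly_continuous_slice R d _ t (@field_continuous i)).
- by move=> x; have /derive_line[] := @field_derivative i t x tT.
- rewrite field_partial//.
  exact: (@jointly_continuous_slice R d _ t (@field'_continuous i)).
Qed.

(** Both sides are [grad L . g]. This is the cancellation hypothesis of [divergence_sum]. *)
Let third_order t x : \sum_i \sum_j J [:: Some i; Some i; Some j] t x * g j t x =
  \sum_i (\sum_j J [:: Some i; Some j; Some j] t x) * g i t x.
Proof.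
have E i j : J [:: Some i; Some i; Some j] t x = J [:: Some j; Some i; Some i] t x.
  (* Two transpositions: the inner pair of derivatives is exchanged first, which needs the equality
     as functions of [x], then the outer pair. *)
  rewrite jet_partial (_ : J [:: Some i; Some j] t = J [:: Some j; Some i] t).
    by rewrite -jet_partial; exact: jet_space_space.
  by apply/funext => y; exact: jet_space_space.
rewrite exchange_big; apply: eq_bigr => j _; rewrite mulr_suml.
by apply: eq_bigr => i _; rewrite E.
Qed.

Lemma energyE t : t \in `[0, T] ->
  energy B m (h t) = torus_integral B (density t).
Proof.
move=> tT; congr torus_integral; apply/funext => x; rewrite /density /sqnorm.
rewrite jetE//; apply: (congr2 *%R) => //.
by apply: eq_bigr => i _; rewrite jetE// mxE expr2.
Qed.

Lemma energy_derivative t : t \in `[0, T] ->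
  derivable_within `[0, T] (fun s => energy B m (h s)) t /\
  derive_within `[0, T] (fun s => energy B m (h s)) t =
  torus_integral B (density' t).
Proof.
move=> tT; have [a aT at_] := itv_neq T0 tT.
apply: (has_derivative_within_unique (itv_interval (T := T)) tT aT at_).
apply: (eq_has_derivative_within tT (f := fun s => `|\det B| *
    cube_integral (fun y : 'rV[R]_d => density s (y *m B)))).
  by move=> s sT; rewrite energyE.
have cB : continuous (fun p : R * 'rV[R]_d => (p.1, p.2 *m B)).
  apply: continuous_pair; first by move=> p; exact: cvg_fst.
  by apply: continuous_mulmx => p; exact: cvg_snd.
have := @cube_integral_derivative R d `[0, T]%classic
  (fun s y => density s (y *m B)) (fun s y => density' s (y *m B)) t.
move=> /(_ (itv_interval (T := T)) tT (continuous_compose density_continuous cB)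
  (continuous_compose density'_continuous cB)) dI.
have := has_derivative_withinM
  (has_derivative_within_cst `[0, T]%classic t `|\det B|) (dI _).
rewrite mul0r add0r; apply => s y sT.
exact: (@density_derivative s (y *m B) sT).
Qed.

Hypothesis h_eq : forall t x, t \in `[0, T] ->
  derive_within `[0, T] (h ^~ x) t
  - divergence (fun y => h t y *: grad (h t) y) x = 0.

(** The product rule for [div (h grad h)] puts the equation into the non-divergence form used in the
    pointwise inequality. *)
Lemma jet_equation t x : t \in `[0, T] ->
  ut t x = \sum_i g i t x * g i t x + u t x * \sum_i H i i t x.
Proof.
move=> tT; have /eqP := @h_eq t x tT; rewrite subr_eq0 => /eqP E.
rewrite jetE//= E /divergence mulr_sumr -big_split/=.
apply: eq_bigr => i _.
have [_ dE] := @derive_line R _ (fun y => u t y * g i t y) x (delta_mx 0 i) _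
  (has_st_derivativeM (@dJ (Some i) [::] t x tT)
     (@dJ (Some i) [:: Some i] t x tT)).
rewrite -dE /partial; apply: (congr1 (fun k => 'D_(delta_mx 0 i) k x)).
by apply/funext => y; rewrite !mxE !jetE.
Qed.

Lemma energy_dissipation t : 0 <= m -> t \in `[0, T] ->
  torus_integral B (density' t) + I_ B m (h t) <= 0.
Proof.
move=> m0 tT.
pose f1 t x := u t x `^ (m + 1) * (\sum_i H i i t x) ^+ 2.
pose f2 t x := u t x `^ (m - 1) * (\sum_i g i t x * g i t x) ^+ 2.
have cf1 : jointly_continuous f1 by rewrite /f1; jcont.
have cf2 : jointly_continuous f2 by rewrite /f2; jcont.
have -> : I_ B m (h t) = m / (m + 1) * torus_integral B (f1 t) +
    C_ m * torus_integral B (f2 t).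
  rewrite /I_; apply: (congr2 +%R); apply: (congr2 *%R) => //;
    apply: (congr1 (torus_integral B)); apply/funext => x.
    rewrite /f1 jetE// real_normK ?num_real//; apply: (congr2 *%R) => //.
    apply: (congr1 (fun z => z ^+ 2)); apply: eq_bigr => i _; rewrite jetE//=.
    rewrite /partial; apply: (congr1 (fun k => 'D_(delta_mx 0 i) k x)).
    by apply/funext => y; rewrite mxE.
  rewrite /f2 jetE//; apply: (congr2 *%R) => //.
  apply: (congr1 (fun z => z ^+ 2)).
  by apply: eq_bigr => i _; rewrite jetE// mxE expr2.
have cs (f : R -> 'rV[R]_d -> R) : jointly_continuous f -> continuous (f t).
  exact: jointly_continuous_slice.
rewrite -!torus_integralZ; [|exact: cs..].
have c1 : jointly_continuous (fun t x => m / (m + 1) * f1 t x).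
  by apply: jointly_continuousM => //; exact: jointly_continuous_cst.
have c2 : jointly_continuous (fun t x => C_ m * f2 t x).
  by apply: jointly_continuousM => //; exact: jointly_continuous_cst.
have cd : jointly_continuous (fun t x => -1 * \sum_i field' i t x).
  apply: jointly_continuousM; first exact: jointly_continuous_cst.
  exact: jointly_continuous_sum.
have cF1 : jointly_continuous (fun t x => density' t x + m / (m + 1) * f1 t x).
  exact: jointly_continuousD.
have cF : jointly_continuous (fun t x =>
    density' t x + m / (m + 1) * f1 t x + C_ m * f2 t x).
  exact: jointly_continuousD.
rewrite addrA -torus_integralD; [|exact: cs|exact: (cs _ c1)].
rewrite -torus_integralD; [|exact: (cs _ cF1)|exact: (cs _ c2)].
set F := (X in torus_integral B X).
(* The integral of minus the divergence of [G] is added; each of its summands integrates to zero. *)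
have -> : torus_integral B F = torus_integral B F +
    torus_integral B (fun x => -1 * \sum_i field' i t x).
  rewrite torus_integralZ; last first.
    exact: (cs (fun t x => \sum_i field' i t x) (jointly_continuous_sum _)).
  rewrite torus_integral_sum; last by move=> i; exact: cs.
  by rewrite big1 ?mulr0 ?addr0// => i _; exact: field_integral.
rewrite -torus_integralD; [|exact: (cs _ cF)|exact: (cs _ cd)].
apply: torus_integral_le0; first exact: (cs _ (@jointly_continuousD R d _ _ cF cd)).
move=> x; rewrite /F mulN1r.
(* All powers are reduced to [p = u^(m-1)]; positivity of [u] allows this even when [m - 1] is
   negative. *)
have Em : u t x `^ m = u t x `^ (m - 1) * u t x by rewrite -powR_succ// subrK.
have Em1 : u t x `^ (m + 1) = u t x `^ (m - 1) * u t x * u t x.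
  by rewrite powR_succ// Em.
have Ed : \sum_i (J [:: None; Some i] t x * g i t x
      + g i t x * J [:: None; Some i] t x) =
    \sum_i (J [:: Some i; None] t x * g i t x + g i t x * J [:: Some i; None] t x).
  by apply: eq_bigr => i _; rewrite jet_time_space.
have m1 : m + 1 - 1 = m by rewrite addrK.
rewrite /density' /f1 /f2 /field' /A Ed m1 Em1 Em.
exact: (@pointwise_dissipation R d (fun i => g i t x)
  (fun i => J [:: Some i; None] t x)
  (fun i => \sum_j J [:: Some i; Some j; Some j] t x)
  (fun i j => H i j t x) (fun i j => J [:: Some i; Some i; Some j] t x)
  (u t x `^ (m - 1)) (u t x) (ut t x) (\sum_i H i i t x) m
  (powR_ge0 _ _) m0 erefl (@jet_equation t x tT) (third_order t x)).
Qed.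

End Dissipation.

Theorem proposition6p4 (R : realType) (d : nat) (hd : (0 < d)%N)
  (B : 'M[R]_d) (hB : B \in unitmx)
  (T : R) (hT : 0 < T)
  (h : R -> 'rV[R]_d -> R)
  (h_periodic : forall t : R, t \in `[0, T] -> lattice_periodic B (h t))
  (h_smooth : smooth_on_strip T h)
  (h_pos : forall (t : R) (x : 'rV[R]_d), t \in `[0, T] -> 0 < h t x)
  (h_eq : forall (t : R) (x : 'rV[R]_d), t \in `[0, T] ->
     derive_within `[0, T] (h ^~ x) t
     - divergence (fun y => h t y *: grad (h t) y) x = 0)
  (m : R) (hm0 : 0 <= m) (hm1 : m <= (1 + Num.sqrt 7) / 2) :
  0 <= C_ m /\
  forall t : R, t \in `[0, T] ->
    derivable_within `[0, T] (fun s => energy B m (h s)) t /\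
    derive_within `[0, T] (fun s => energy B m (h s)) t + I_ B m (h t) <= 0.
Proof.
split; first exact: C_ge0.
move=> t tT.
have [dE ->] := energy_derivative B hT h_smooth h_pos m tT.
by split => //; exact: energy_dissipation.
Qed.
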